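(* Let $d\ge 4$, let $\{X_n\}_{n=0}^\infty$ be a $d$-dimensional simple random walk starting at $0$, and let $P_d$ be the probability that $\{X_n\}_{n=0}^\infty$ ever returns to the $d$-dimensional diagonal line, i.e. $P_d=P(\exists\, n\ge 1:\ X_n\in\{(m,m,\dots,m): m\in\mathbb{Z}\})$. Then $P_d\in(0,1)$, and for every integer $N\ge 1$ and every nearest neighbor path $\mathcal{P}=(P_0,P_1,\dots,P_K)$ in $\mathbb{Z}^d$ connecting $0$ and $\partial B_1(0,N)$, $$P\left(\mathrm{Trace}(\mathcal{P})\subseteq \mathrm{Trace}\big(\{X_n\}_{n=0}^\infty\big)\right)\le P_d^{[N/d]}.$$
   Context: $[\cdot]$ is the integer part (floor), and $\partial B_1(0,N)=\{x\in\mathbb{Z}^d:\|x\|_1=N\}$. A nearest neighbor path $\mathcal{P}=(P_0,\dots,P_K)$ (consecutive points at $L_1$-distance $1$) connects $0$ and $\partial B_1(0,N)$ if $P_0=0$ and $\inf\{n:\|P_n\|_1=N\}=K$. $\mathrm{Trace}$ of a (finite or infinite) sequence of points is the set of points appearing in it. $d$-dimensional simple random walk moves at each step to one of the $2d$ nearest neighbors with equal probability, independently. *)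

(* Defs.v *)
From HB Require Import structures.
From mathcomp Require Import all_boot all_order all_algebra.
From mathcomp Require Import all_classical all_reals all_analysis.

Set Implicit Arguments.
Unset Strict Implicit.
Unset Printing Implicit Defensive.

Import Order.TTheory GRing.Theory Num.Theory.
Local Open Scope classical_set_scope.
Local Open Scope ring_scope.

(* Points of Z^d are row vectors with integer entries. *)
Definition l1norm (d : nat) (x : 'rV[int]_d) : nat :=
  (\sum_(i < d) absz (x ord0 i))%N.

Definition diagonal (d : nat) : set 'rV[int]_d :=
  [set x | exists m : int, x = const_mx m].

Definition trace (I U : Type) (s : I -> U) : set U := [set x | exists i, s i = x].

(* inf {n : |P_n|_1 = N} = K is expressed by its last two clauses. *)
Record connects_to_sphere (d N K : nat) (p : 'I_K.+1 -> 'rV[int]_d) : Prop :=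
  ConnectsToSphere {
    path_start : p ord0 = 0;
    path_step : forall i j : 'I_K.+1, j = i.+1 :> nat ->
      l1norm (p j - p i) = 1%N;
    path_end : l1norm (p ord_max) = N;
    path_first_hit : forall i : 'I_K.+1, (i < K)%N -> l1norm (p i) <> N
  }.

(* Joint independence for the discrete sigma-algebra on U: all subsets of U
   are test sets. *)
Definition mutually_independent (R : realType) (disp : measure_display)
    (T : measurableType disp) (P : probability T R) (U : Type)
    (xi : nat -> T -> U) : Prop :=
  forall (J : seq nat) (A : nat -> set U), uniq J ->
    P (\bigcap_(i in [set` J]) (xi i @^-1` A i)) =
    (\prod_(i <- J) P (xi i @^-1` A i))%E.

Definition increment (T : Type) (d : nat) (X : nat -> T -> 'rV[int]_d)
    (n : nat) (w : T) : 'rV[int]_d := X n.+1 w - X n w.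

(* Measurability is with respect to the discrete sigma-algebra on Z^d. *)
Record simple_random_walk (R : realType) (disp : measure_display)
    (T : measurableType disp) (P : probability T R) (d : nat)
    (X : nat -> T -> 'rV[int]_d) : Prop := SimpleRandomWalk {
  srw_measurable : forall n (A : set 'rV[int]_d), measurable (X n @^-1` A);
  srw_start : forall w, X 0%N w = 0;
  srw_step : forall n (e : 'rV[int]_d), l1norm e = 1%N ->
    P [set w | increment X n w = e] = ((2 * d)%:R^-1)%:E;
  srw_indep : mutually_independent P (increment X)
}.

Definition diagonal_return (T : Type) (d : nat) (X : nat -> T -> 'rV[int]_d)
  : set T := [set w | exists n : nat, (1 <= n)%N /\ diagonal (X n w)].

(* Main.v *)
Require Import Defs.
From HB Require Import structures.
From mathcomp Require Import all_boot all_order all_algebra all_fingroup.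
From mathcomp Require Import all_classical all_reals all_analysis.
From mathcomp Require Import ring lra zify.

Set Implicit Arguments.
Unset Strict Implicit.
Unset Printing Implicit Defensive.

Import Order.TTheory GRing.Theory Num.Theory.
Local Open Scope classical_set_scope.
Local Open Scope ring_scope.

(** Why the theorem holds.

    Folding.  Let H be a hyperplane whose reflection phi preserves Z^d and the
    walk, and which a nearest neighbour path cannot cross without stepping on
    it.  If the walk starts on the left of H, then moving the part of a finite
    target set S that lies on the right of H to the left, by phi, does not
    decrease the probability that the walk covers S ([cover_fold]).
    Heuristically, given the walk folded onto the left side, each excursion
    away from H goes to a side chosen by a fair coin; targets on opposite sides
    compete for these coins, while targets on the same side need the same
    outcomes.  The proof replaces this correlation inequality by an induction
    on the number of steps, whose only probabilistic input is the
    supermodularity of S |-> P(S is covered) ([cover_prob_supermodular]).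

    Reduction to the diagonal.  The L1 norm along the path starts at 0, ends at
    N and changes by at most 1, so the path has a point of norm j * d for each
    1 <= j <= N %/ d; keep only these points.  Folding along x_i = 0 replaces
    coordinates by absolute values, so that the coordinate sum of the j-th
    point becomes j * d.  Folding along x_i - x_j = 1 keeps coordinate sums and
    decreases sums of squares, so after finitely many folds all coordinates of
    each point differ by at most 1 and the j-th point is (j, ..., j)
    ([cover_straighten]).  All these hyperplanes have the origin on their left
    side.  Covering N %/ d points of the diagonal other than 0 requires as many
    returns to the diagonal, and the diagonal is invariant under translation by
    its points, whence the power of P_d ([cover_le_hit]).

    0 < P_d < 1.  Two steps may return to 0.  For the upper bound, let Q(x) be
    the squared distance from x to the diagonal.  Modulo the diagonal the walk
    is a walk in dimension d - 1 >= 3, where |y| ^ (-1/2) decays more slowly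
    than the Green function and is superharmonic away from 0; the shifted
    function (Q + a) ^ (-1/4) is superharmonic at every lattice point once a is
    large ([pot_superharmonic]).  It is maximal on the diagonal, so it controls
    the probability to hit the diagonal from a neighbour of 0
    ([return_prob_bounded_away]).

    Everything is computed with n-step averages defined by recursion on the
    first step; [prob_walk] identifies them with probabilities, and monotone
    limits in n give the theorem. *)

(** * Steps of the walk *)

Notation site d := 'rV[int]_d.
Notation dir d := ('I_d * bool)%type.

Definition stepv d (e : dir d) : site d := (-1) ^+ e.2 *: delta_mx ord0 e.1.

Lemma stepvE d (e : dir d) i : stepv e ord0 i = (-1) ^+ e.2 * (i == e.1)%:R.
Proof. by rewrite !mxE eqxx. Qed.

Lemma siteD d (x y : site d) k : (x + y) ord0 k = x ord0 k + y ord0 k.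
Proof. by rewrite mxE. Qed.

Lemma site_ext d (x y : site d) : x ord0 =1 y ord0 -> x = y.
Proof. by move=> xy; apply/rowP. Qed.

Lemma stepv_ge_N1_le1 d (e : dir d) k : -1 <= stepv e ord0 k <= 1.
Proof. by rewrite stepvE; case: e.2 (k == e.1) => [] []. Qed.

Lemma l1norm_stepv d (e : dir d) : l1norm (stepv e) = 1%N.
Proof.
rewrite /l1norm (bigD1 e.1)//= stepvE eqxx mulr1 big1 => [|k /negPf ke].
  by case: e.2.
by rewrite stepvE ke mulr0.
Qed.

Lemma stepv_inj d : injective (@stepv d).
Proof.
move=> [k b] [l c] /(congr1 (fun x : site d => x ord0 k)).
rewrite !stepvE eqxx /= mulr1; case: (eqVneq k l) => [->|_].
  by case: b c => [] [].
by case: b; rewrite mulr0.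
Qed.

Lemma card_dir d : #|{: dir d}| = (2 * d)%N.
Proof. by rewrite card_prod card_ord card_bool mulnC. Qed.

(** * Averages over walks of fixed length *)

Section Averages.
Variables (R : realType) (d : nat).
Implicit Types (x y z : site d) (S A B : seq (site d)) (g h : site d -> R).

Definition nbr_avg g x : R :=
  (2 * d)%:R^-1 * \sum_(e : dir d) g (x + stepv e).

(** Expectation of F (x_0, ..., x_(n-1)) for the walk with x_0 = x.  It is [n]
    positions, not [n] steps, that are recorded, so that the empty walk is the
    base case of every induction below. *)
Fixpoint path_avg n (F : seq (site d) -> R) x : R :=
  if n is m.+1 then nbr_avg (path_avg m (fun l => F (x :: l))) x else F [::].

Lemma ler_nbr_avg g h x :
  (forall e, g (x + stepv e) <= h (x + stepv e)) -> nbr_avg g x <= nbr_avg h x.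
Proof. by move=> gh; rewrite ler_wpM2l ?invr_ge0 ?ler0n// ler_sum. Qed.

Lemma eq_nbr_avg g h x : g =1 h -> nbr_avg g x = nbr_avg h x.
Proof. by move=> gh; congr (_ * _); apply: eq_bigr => e _; rewrite gh. Qed.

Lemma nbr_avgD g h x :
  nbr_avg (fun z => g z + h z) x = nbr_avg g x + nbr_avg h x.
Proof. by rewrite /nbr_avg big_split mulrDr. Qed.

Lemma nbr_avgZ (a : R) g x : nbr_avg (fun z => a * g z) x = a * nbr_avg g x.
Proof. by rewrite /nbr_avg -mulr_sumr mulrCA. Qed.

Lemma nbr_avg_cst (a : R) x : (0 < d)%N -> nbr_avg (fun=> a) x = a.
Proof.
move=> d0; rewrite /nbr_avg sumr_const card_dir -[a *+ _]mulr_natl mulKf//.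
by rewrite pnatr_eq0 muln_eq0 -lt0n d0.
Qed.

Lemma eq_path_avg n F G x : F =1 G -> path_avg n F x = path_avg n G x.
Proof.
elim: n F G x => [|n IH] F G x FG /=; first exact: FG.
by apply: eq_nbr_avg => z; apply: IH => l; exact: FG.
Qed.

Lemma ler_path_avg n F G x : (forall l, F l <= G l) ->
  path_avg n F x <= path_avg n G x.
Proof.
elim: n F G x => [|n IH] F G x FG /=; first exact: FG.
by apply: ler_nbr_avg => e; apply: IH => l; exact: FG.
Qed.

Lemma path_avg_cst n (a : R) x : (0 < d)%N -> path_avg n (fun=> a) x = a.
Proof.
move=> d0; elim: n x => //= n IH x.
by rewrite (eq_nbr_avg _ (h := fun=> a))// nbr_avg_cst.
Qed.

Lemma path_avgD n F G x :
  path_avg n (fun l => F l + G l) x = path_avg n F x + path_avg n G x.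
Proof.
elim: n F G x => //= n IH F G x.
by rewrite -nbr_avgD; apply: eq_nbr_avg => z; rewrite IH.
Qed.

Definition cover_prob n S : site d -> R :=
  path_avg n (fun l => (all [in l] S)%:R).

Lemma cover_prob0 S x : cover_prob 0 S x = (nilp S)%:R.
Proof. by case: S. Qed.

(** The Markov property: the current position is struck off the targets and the
    walk starts afresh from a neighbour. *)
Lemma cover_probS n S x :
  cover_prob n.+1 S x = nbr_avg (cover_prob n [seq y <- S | y != x]) x.
Proof.
rewrite /cover_prob /=; apply: eq_nbr_avg => z; apply: eq_path_avg => l.
congr (_%:R).
congr nat_of_bool; elim: S => //= y S ->; rewrite inE; by case: eqP.
Qed.

Lemma cover_prob_subset n S S' x : {subset S <= S'} ->
  cover_prob n S' x <= cover_prob n S x.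
Proof.
move=> sSS'; apply: ler_path_avg => l; rewrite ler_nat.
case: allP => // h; rewrite lt0n eqb0 negbK.
by apply/allP => y /sSS'; exact: h.
Qed.

Lemma eq_cover_prob n S S' x : S =i S' -> cover_prob n S x = cover_prob n S' x.
Proof.
by move=> SS'; apply/eqP; rewrite eq_le !cover_prob_subset// => y; rewrite SS'.
Qed.

(** Covering both A1 ++ B2 and A2 ++ B1 amounts to covering A2 ++ B2, while
    covering either of them covers A1 ++ B1; the inequality is
    1_U + 1_V <= 1_(U :|: V) + 1_(U :&: V) under the expectation. *)
Lemma cover_prob_supermodular n A1 A2 B1 B2 x :
  {subset A1 <= A2} -> {subset B1 <= B2} ->
  cover_prob n (A1 ++ B2) x + cover_prob n (A2 ++ B1) x <=
  cover_prob n (A1 ++ B1) x + cover_prob n (A2 ++ B2) x.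
Proof.
move=> sA sB; rewrite -!path_avgD; apply: ler_path_avg => l.
rewrite -!natrD ler_nat !all_cat.
have hA : all [in l] A2 ==> all [in l] A1.
  by apply/implyP => /allP h; apply/allP => y /sA /h.
have hB : all [in l] B2 ==> all [in l] B1.
  by apply/implyP => /allP h; apply/allP => y /sB /h.
by case: (all _ A1) (all _ A2) (all _ B1) (all _ B2) hA hB => [] [] [] [].
Qed.

(** * Folding along a hyperplane *)

(** [height] is a signed distance to the mirror.  That a step raises it by at
    most 1 is what forces a path to visit the mirror when it changes sides. *)
Record lattice_reflection := LatticeReflection {
  refl :> site d -> site d;
  height : site d -> int;
  refl_dir : dir d -> dir d;
  reflK : involutive refl;
  refl_dirK : involutive refl_dir;
  refl_step : forall x e, refl (x + stepv e) = refl x + stepv (refl_dir e);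
  height_refl : forall x, height (refl x) = - height x;
  height0 : forall x, height x = 0 -> refl x = x;
  height_step : forall x e, height (x + stepv e) <= height x + 1 }.

Section Fold.
Variable phi : lattice_reflection.
Let left x := height phi x <= 0.

Lemma nbr_avg_refl g x : nbr_avg (g \o phi) x = nbr_avg g (phi x).
Proof.
rewrite /nbr_avg; congr (_ * _).
rewrite [RHS](reindex_inj (inv_inj (@refl_dirK phi))).
by apply: eq_bigr => e _; rewrite /= refl_step.
Qed.

Lemma filter_map_refl x S :
  [seq y <- map phi S | y != phi x] = map phi [seq y <- S | y != x].
Proof.
by rewrite filter_map; congr map; apply: eq_filter => y /=;
   rewrite (inj_eq (inv_inj (@reflK phi))).
Qed.

Lemma cover_prob_refl n S x :
  cover_prob n (map phi S) (phi x) = cover_prob n S x.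
Proof.
elim: n S x => [|n IH] S x; first by rewrite !cover_prob0; case: S.
rewrite !cover_probS filter_map_refl -nbr_avg_refl; apply: eq_nbr_avg => z /=.
exact: IH.
Qed.

Lemma map_reflK S : map phi (map phi S) = S.
Proof. by apply: mapK; exact: reflK. Qed.

(** Reflecting the starting point or the targets is the same; used to bring
    every starting point back to the left side. *)
Lemma cover_prob_preim_refl n S x :
  cover_prob n S (phi x) = cover_prob n (map phi S) x.
Proof. by rewrite -[in LHS](map_reflK S) cover_prob_refl. Qed.

Lemma left_or_refl x : left x || left (phi x).
Proof. by rewrite /left height_refl oppr_le0; case: leP => // /ltW. Qed.

Lemma on_wall x : left x -> left (phi x) -> phi x = x.
Proof.
rewrite /left height_refl oppr_le0 => h1 h2.
by apply: height0; apply/eqP; rewrite eq_le h1 h2.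
Qed.

Lemma left_step x e : left x -> phi x != x -> left (x + stepv e).
Proof.
rewrite /left => h1 /eqP h2; apply: (le_trans (height_step _ _ _)).
have : height phi x <> 0 by move=> /height0.
lia.
Qed.

Lemma filter_refl_left x S : all left S -> left x -> phi x != x ->
  [seq y <- map phi S | y != x] = map phi S.
Proof.
move=> /allP lS lx nx; apply/all_filterP/allP => _ /mapP[y /lS ly ->].
by apply: contraNneq nx => E; apply/eqP; rewrite on_wall// -E reflK.
Qed.

Lemma all_filterl (a b : pred (site d)) A :
  all b A -> all b [seq y <- A | a y].
Proof.
by move=> /allP h; apply/allP => y; rewrite mem_filter => /andP[_ /h].
Qed.

(** The inductive form of the folding inequality.  The left-hand side is twice
    the covering probability of A ++ map phi B for a walk that sits at y or at
    its mirror image according to a fair coin, the right-hand side the same for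
    A ++ B.  Here A2, B2 are the targets open when the current excursion left
    the mirror, and A1, B1 what remains of them after the points visited since
    are removed, which concerns only the targets on the side where the excursion
    takes place. *)
Definition two_sided n := forall y A1 A2 B1 B2, left y ->
  all left A2 -> all left B2 -> {subset A1 <= A2} -> {subset B1 <= B2} ->
  cover_prob n (A1 ++ map phi B2) y + cover_prob n (B1 ++ map phi A2) y <=
  cover_prob n (A1 ++ B1) y + cover_prob n (map phi A2 ++ map phi B2) y.

Lemma nbr_avg_wall g y : phi y = y ->
  nbr_avg g y = 2^-1 * nbr_avg (fun z => g z + g (phi z)) y.
Proof.
move=> hy; rewrite nbr_avgD (nbr_avg_refl g) hy; lra.
Qed.

(** On the mirror the next excursion goes left or right with equal probability,
    so the next step may be averaged over pairs of mirror neighbours; for each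
    pair the inequality is [two_sided] with nothing visited yet. *)
Lemma cover_fold_wall n A B y : two_sided n -> phi y = y ->
  all left A -> all left B ->
  cover_prob n.+1 (A ++ map phi B) y <= cover_prob n.+1 (A ++ B) y.
Proof.
move=> IH hy lA lB; rewrite !cover_probS !filter_cat -{2}hy filter_map_refl.
have := all_filterl (fun z => z != y) lA.
have := all_filterl (fun z => z != y) lB.
set A' := [seq _ <- A | _]; set B' := [seq _ <- B | _] => lB' lA'.
rewrite nbr_avg_wall// [leRHS]nbr_avg_wall// ler_wpM2l ?invr_ge0//.
apply: ler_nbr_avg => e.
set z := y + _; rewrite !cover_prob_preim_refl !map_cat map_reflK.
have sw C D x : cover_prob n (C ++ D) x = cover_prob n (D ++ C) x.
  by apply: eq_cover_prob => u; rewrite !mem_cat orbC.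
have [lz|lz] := orP (left_or_refl z).
  (* The neighbour z is on the left; otherwise its mirror image is. *)
  by rewrite [X in _ + X <= _]sw; apply: IH.
have := IH (phi z) A' A' B' B' lz lA' lB' (fun=> id) (fun=> id).
rewrite !cover_prob_preim_refl !map_cat !map_reflK.
rewrite [cover_prob n (map phi B' ++ A') _]sw => ?; lra.
Qed.

(** Off the mirror the inequality passes to every neighbour, since the current
    point can only be struck off the sets on its own side.  On the mirror the
    excursion is over: [cover_fold_wall] folds each of the two terms, and
    supermodularity compares the results. *)
Lemma two_sidedP n : two_sided n.
Proof.
elim: n => [|n IH] y A1 A2 B1 B2 ly lA lB sA sB.
  have sub_nil (C D : seq (site d)) : {subset C <= D} -> nilp D ==> nilp C.
    by move=> s; apply/implyP => /nilP D0; case: C s => // c C /(_ c);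
       rewrite D0 inE eqxx => /(_ isT).
  have nil_cat (C D : seq (site d)) : nilp (C ++ D) = nilp C && nilp D.
    by case: C.
  have nil_map (C : seq (site d)) : nilp (map phi C) = nilp C by case: C.
  rewrite !cover_prob0 -!natrD ler_nat !nil_cat !nil_map.
  move: (sub_nil _ _ sA) (sub_nil _ _ sB).
  by case: (nilp A1) (nilp A2) (nilp B1) (nilp B2) => [] [] [] [].
have sub_all C D : {subset C <= D} -> all left D -> all left C.
  by move=> s /allP h; apply/allP => u /s/h.
have [hy|ny] := eqVneq (phi y) y.
  have lA1 := sub_all _ _ sA lA; have lB1 := sub_all _ _ sB lB.
  have h1 := cover_fold_wall IH hy lA1 lB.
  have h2 := cover_fold_wall IH hy lB1 lA.
  have h3 := cover_prob_supermodular n.+1 y sA sB.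
  rewrite -map_cat -cover_prob_preim_refl hy.
  have sw : cover_prob n.+1 (B1 ++ A2) y = cover_prob n.+1 (A2 ++ B1) y.
    by apply: eq_cover_prob => u; rewrite !mem_cat orbC.
  rewrite sw in h2; lra.
rewrite !cover_probS !filter_cat !(filter_refl_left _ ly ny)// -!nbr_avgD.
apply: ler_nbr_avg => e; apply: IH => //; first exact: left_step.
- by move=> u; rewrite mem_filter => /andP[_ /sA].
- by move=> u; rewrite mem_filter => /andP[_ /sB].
Qed.

Lemma cover_fold_cat n A B y : left y -> all left A -> all left B ->
  cover_prob n (A ++ map phi B) y <= cover_prob n (A ++ B) y.
Proof.
elim: n A y => [|n IH] A y ly lA lB.
  by rewrite !cover_prob0 /nilp !size_cat size_map.
have [hy|ny] := eqVneq (phi y) y.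
  by apply: cover_fold_wall => //; exact: two_sidedP.
rewrite !cover_probS !filter_cat filter_refl_left//; apply: ler_nbr_avg => e.
apply: (le_trans (IH _ _ (left_step _ ly ny) (all_filterl _ lA) lB)).
apply: cover_prob_subset => u; rewrite !mem_cat !mem_filter.
by case/orP => [->//|/andP[_ ->]]; rewrite orbT.
Qed.

Definition fold x := if height phi x <= 0 then x else phi x.

Lemma cover_fold n S y : height phi y <= 0 ->
  cover_prob n S y <= cover_prob n (map fold S) y.
Proof.
move=> ly; pose A := [seq x <- S | left x].
pose B := map phi [seq x <- S | ~~ left x].
have SE : S =i A ++ map phi B.
  move=> u; rewrite map_reflK mem_cat !mem_filter.
  by case: (left u); rewrite ?orbF.
have FE : {subset map fold S <= A ++ B}.
  move=> _ /mapP[u uS ->]; rewrite mem_cat /fold.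
  case lu: (height phi u <= 0); first by rewrite mem_filter /left lu uS.
  by apply/orP; right; apply/mapP; exists u; rewrite // mem_filter /left lu.
rewrite (eq_cover_prob _ _ SE).
apply: le_trans (cover_prob_subset _ _ FE); apply: cover_fold_cat => //.
- by apply/allP => u; rewrite mem_filter => /andP[].
- apply/allP => _ /mapP[u + ->]; rewrite mem_filter => /andP[nu _].
  by have := left_or_refl u; rewrite (negPf nu).
Qed.

End Fold.
End Averages.

(** * The two families of reflections *)

Section CoordReflection.
Variables (d : nat) (i : 'I_d).

Definition coord_refl_fun (x : site d) : site d :=
  \row_k (if k == i then - x ord0 k else x ord0 k).

Definition coord_refl_dir (e : dir d) : dir d := (e.1, (e.1 == i) (+) e.2).

Definition coord_refl : lattice_reflection d.
Proof.
apply: (@LatticeReflection d coord_refl_fun (fun x => - x ord0 i)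
  coord_refl_dir).
- by move=> x; apply: site_ext => k; rewrite !mxE; case: eqP; rewrite ?opprK.
- by case=> k b; rewrite /coord_refl_dir /= addbA addbb.
- move=> x e; apply: site_ext => k; rewrite !mxE !eqxx /= signr_addb.
  case: (eqVneq k i) => [->|ki].
    by rewrite opprD [i == e.1]eq_sym; case: eqP;
       rewrite /= ?mulr0 ?mulr1 ?oppr0 ?mulN1r.
  by case: (eqVneq k e.1) => [<-|]; rewrite ?mulr0// (negPf ki) expr0 mul1r.
- by move=> x; rewrite !mxE eqxx.
- move=> x /eqP; rewrite oppr_eq0 => /eqP x0.
  apply: site_ext => k; rewrite !mxE.
  by case: eqP => // ->; rewrite x0 oppr0.
- by move=> x e; have := stepv_ge_N1_le1 e i; rewrite siteD; lia.
Defined.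
End CoordReflection.

Section SwapReflection.
Variables (d : nat) (i j : 'I_d).
Hypothesis ij : i != j.

(** Reflection in x_i - x_j = 1: it maps (x_i, x_j) to (x_j + 1, x_i - 1). *)
Definition swap_refl_fun (x : site d) : site d :=
  \row_k (x ord0 (tperm i j k) + (k == i)%:R - (k == j)%:R).

Definition swap_refl : lattice_reflection d.
Proof.
apply: (@LatticeReflection d swap_refl_fun
  (fun x => x ord0 i - x ord0 j - 1) (fun e => (tperm i j e.1, e.2))).
- move=> x; apply: site_ext => k; rewrite !mxE tpermK.
  have -> : (tperm i j k == i) = (k == j).
    by rewrite (can2_eq (tpermK i j) (tpermK i j)) tpermL.
  have -> : (tperm i j k == j) = (k == i).
    by rewrite (can2_eq (tpermK i j) (tpermK i j)) tpermR.
  ring.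
- by move=> [k b]; rewrite /= tpermK.
- move=> x e; apply: site_ext => k; rewrite !mxE !eqxx /=.
  rewrite (can2_eq (tpermK i j) (tpermK i j)); ring.
- move=> x; rewrite !mxE tpermL tpermR !eqxx [j == i]eq_sym (negPf ij) /=; lia.
- move=> x h; apply: site_ext => k; rewrite !mxE.
  case: tpermP => [->|->|/eqP/negPf -> /eqP/negPf ->];
    rewrite ?eqxx ?(negPf ij).
  + rewrite /=; lia.
  + rewrite [j == i]eq_sym (negPf ij) /=; lia.
  + by rewrite addr0 subr0.
- move=> x e; rewrite !siteD.
  have := stepv_ge_N1_le1 e i; have := stepv_ge_N1_le1 e j.
  rewrite !stepvE; case: (eqVneq i e.1) (eqVneq j e.1) => [ei|ni] [ej|nj];
    rewrite ?mulr0 ?mulr1; lia.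
Defined.
End SwapReflection.

(** * Folding finite sets onto the diagonal *)

Section Straighten.
Variables (R : realType) (d : nat).
Implicit Types S : seq (site d).
Local Notation cover_prob := (@cover_prob R d).

Definition abs_on (I : seq 'I_d) (x : site d) : site d :=
  \row_k (if k \in I then `|x ord0 k| else x ord0 k).

Lemma cover_abs n S :
  cover_prob n S 0 <= cover_prob n (map (abs_on (enum 'I_d)) S) 0.
Proof.
elim: (enum _) => [|i I IH].
  have -> : map (abs_on [::]) S = S; last by [].
  rewrite -[RHS]map_id; apply: eq_map => x.
  by apply: site_ext => k; rewrite mxE.
apply: (le_trans IH); rewrite (_ : map (abs_on (i :: I)) S =
    map (fold (coord_refl i)) (map (abs_on I) S)).
  by apply: cover_fold; rewrite /= mxE.
rewrite -map_comp; apply: eq_map => x; apply: site_ext => k /=.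
rewrite /fold /= !mxE oppr_le0 inE.
have [h|h] := boolP (0 <= (if i \in I then `|x ord0 i| else x ord0 i));
  rewrite !mxE; case: (eqVneq k i) => [->|//] /=.
- by case: (i \in I) h => // /ger0_norm.
- case: (i \in I) h => h; last by move: h; rewrite -ltNge => /ltr0_norm.
  by move: h; rewrite normr_ge0.
Qed.

(** The potential that makes the folding procedure of [cover_balance]
    terminate. *)
Definition energy (x : site d) : nat := (\sum_k `|x ord0 k| ^ 2)%N.

Lemma sum_swap i j (x : site d) : i != j ->
  \sum_k swap_refl_fun i j x ord0 k = \sum_k x ord0 k.
Proof.
move=> ij; under eq_bigr do rewrite mxE.
rewrite sumrB big_split /= [X in X + _ - _](_ : _ = \sum_k x ord0 k);
  last first.
  by rewrite [RHS](reindex_inj (@perm_inj _ (tperm i j))).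
have delta l : \sum_(k < d) (k == l)%:R = 1 :> int.
  by rewrite (bigD1 l)//= eqxx big1 ?addr0// => k /negPf ->.
by rewrite !delta addrK.
Qed.

Lemma energy_swap i j (x : site d) : 1 < x ord0 i - x ord0 j ->
  (energy (swap_refl_fun i j x) < energy x)%N.
Proof.
move=> h; have ij : i != j by apply: contraTneq h => ->; rewrite subrr.
have split_ij (y : site d) : energy y = (`|y ord0 i| ^ 2 + `|y ord0 j| ^ 2 +
    \sum_(k | (k != i) && (k != j)) `|y ord0 k| ^ 2)%N.
  by rewrite /energy (bigD1 i)//= (bigD1 j) 1?eq_sym//= addnA.
rewrite !split_ij (eq_bigr (fun k => `|x ord0 k| ^ 2)%N) => [|k /andP[ki kj]].
  rewrite ltn_add2r !mxE tpermL tpermR !eqxx [j == i]eq_sym (negPf ij) /=.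
  have sqE (z : int) : (`|z| ^ 2)%N = z ^+ 2 :> int by rewrite expr2; nia.
  rewrite -ltz_nat !PoszD !sqE; nra.
by rewrite mxE (negPf ki) (negPf kj) tpermD 1?eq_sym// addr0 subr0.
Qed.

(** As long as some target has two coordinates differing by at least 2, fold
    along the corresponding hyperplane x_i - x_j = 1; the total energy of the
    targets decreases strictly. *)
Lemma cover_balance n S : exists g : site d -> site d,
  [/\ cover_prob n S 0 <= cover_prob n (map g S) 0,
      forall x, \sum_k g x ord0 k = \sum_k x ord0 k &
      forall x, x \in S -> forall i j, g x ord0 i <= g x ord0 j + 1].
Proof.
have [m] := ubnP (\sum_(x <- S) energy x)%N; elim: m S => // m IH S Sm.
have [/hasP[x xS /existsP[i /existsP[j hij]]]|] :=
    boolP (has (fun x : site d =>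
      [exists i : 'I_d, exists j : 'I_d, 1 < x ord0 i - x ord0 j]) S).
  have ij : i != j by apply: contraTneq hij => ->; rewrite subrr.
  pose f := fold (swap_refl ij).
  have fE y : f y =
    if y ord0 i - y ord0 j - 1 <= 0 then y else swap_refl_fun i j y by [].
  have le_energy y : (energy (f y) <= energy y)%N.
    rewrite fE; case: ifPn => // /negbTE h.
    by apply: ltnW; apply: energy_swap; lia.
  have /IH[g [h1 h2 h3]] : (\sum_(x <- map f S) energy x < m)%N.
    rewrite -ltnS; apply: (leq_trans _ Sm); rewrite ltnS big_map.
    rewrite (big_rem x xS) [ltnRHS](big_rem x xS) /= -addSn leq_add//.
      rewrite fE ifF; [exact: energy_swap|lia].
    by apply: leq_sum.
  exists (g \o f); split => [|y|y yS].
  - rewrite map_comp; apply: le_trans h1; apply: cover_fold.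
    by rewrite /= !mxE; lia.
  - by rewrite /= h2 fE; case: ifP => // _; rewrite sum_swap.
  - by apply: h3; apply: map_f.
move=> /hasPn h; exists id; split => // [|x /h].
  by rewrite map_id.
rewrite negb_exists => /forallP hx i j; move: (hx i).
rewrite negb_exists => /forallP /(_ j); lia.
Qed.

(** If some x_i < m then all coordinates are at most m by balance, and
    otherwise all are at least m; in both cases the differences from m have one
    sign and sum to 0. *)
Lemma balanced_const (x : site d) (m : int) : (0 < d)%N ->
  (forall i j, x ord0 i <= x ord0 j + 1) -> \sum_k x ord0 k = m * d%:Z ->
  x = const_mx m.
Proof.
move=> d0 bal sx.
have sum_shift : \sum_(k < d) (x ord0 k - m) = 0.
  rewrite sumrB sx sumr_const card_ord -mulr_natr; lia.
have [/forallP ge_m|] := boolP [forall k, m <= x ord0 k]; last first.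
  rewrite negb_forall => /existsP[i hi].
  have : \sum_(k < d) (m - x ord0 k) = 0.
    rewrite -[LHS]opprK -sumrN (eq_bigr _ (fun k _ => opprB _ _)).
    by rewrite sum_shift oppr0.
  move=> /eqP; rewrite psumr_eq0 => [/allP/(_ i)|k _].
    rewrite mem_index_enum => /(_ isT)/=; lia.
  have := bal k i; lia.
apply: site_ext => k; rewrite mxE; move: sum_shift => /eqP.
rewrite psumr_eq0 => [/allP/(_ k)|l _].
  rewrite mem_index_enum => /(_ isT)/=; lia.
by rewrite subr_ge0 ge_m.
Qed.

Lemma cover_straighten n (q : nat -> site d) (s : seq nat) : (0 < d)%N ->
  {in s, forall j, l1norm (q j) = (j * d)%N} ->
  cover_prob n (map q s) 0 <= cover_prob n [seq const_mx (Posz j) | j <- s] 0.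
Proof.
move=> d0 qE; apply: (le_trans (cover_abs n _)); rewrite -map_comp.
have [g [h1 h2 h3]] := cover_balance n (map (abs_on (enum 'I_d) \o q) s).
apply: (le_trans h1); rewrite -map_comp le_eqVlt; apply/orP; left; apply/eqP.
congr (cover_prob n _ 0); apply/eq_in_map => j js /=.
apply: balanced_const => //.
  by apply: h3; apply/mapP; exists j.
rewrite h2 -PoszM -(qE j js) /l1norm (big_morph Posz PoszD (erefl _)).
by apply: eq_bigr => k _; rewrite mxE mem_enum abszE.
Qed.
End Straighten.

(** * Visits to the diagonal *)

Section Hit.
Variables (R : realType) (d : nat).
Hypothesis d_gt0 : (0 < d)%N.
Implicit Types (x y z : site d) (S : seq (site d)).
Local Notation cover_prob := (@cover_prob R d).

Definition on_diag x : bool := `[< Defs.diagonal x >].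

Definition hit_prob n : site d -> R :=
  path_avg n (fun l => (has on_diag l)%:R).

Lemma hit_prob0 x : hit_prob 0 x = 0. Proof. by []. Qed.

Lemma hit_probS n x :
  hit_prob n.+1 x = if on_diag x then 1 else nbr_avg (hit_prob n) x.
Proof.
rewrite /hit_prob /=; case: ifP => dx.
  rewrite (eq_nbr_avg _ (h := fun=> 1)) ?nbr_avg_cst// => z.
  exact: path_avg_cst.
by apply: eq_nbr_avg => z; exact: eq_path_avg.
Qed.

Lemma diag0 : Defs.diagonal (0 : site d).
Proof. by exists 0; apply: site_ext => k; rewrite !mxE. Qed.

Lemma on_diagD x z : on_diag z -> on_diag (x + z) = on_diag x.
Proof.
move=> /asboolP[m ->]; apply: asbool_equiv_eq; split=> -[k].
  move=> E; exists (k - m); rewrite -[x](addrK (const_mx m)) E.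
  by apply/rowP => i; rewrite !mxE.
by move=> ->; exists (k + m); apply/rowP => i; rewrite !mxE.
Qed.

(** What replaces the strong Markov property at a return: after translation the
    walk restarts from the origin. *)
Lemma hit_prob_shift n x z : on_diag z -> hit_prob n (x + z) = hit_prob n x.
Proof.
move=> dz; elim: n x => // n IH x; rewrite !hit_probS on_diagD//.
by case: ifP => // _; congr (_ * _); apply: eq_bigr => e _; rewrite addrAC IH.
Qed.

Lemma cover_prob_le1 n S x : cover_prob n S x <= 1.
Proof.
rewrite -(path_avg_cst n 1 x d_gt0); apply: ler_path_avg => l.
by rewrite lern1 leq_b1.
Qed.

(** The k + 1 targets are distinct and on the diagonal, so the walk has to hit
    the diagonal and then return at least k times. *)
Lemma cover_le_hit (rho : R) n k S x : 0 <= rho ->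
  (forall n, nbr_avg (hit_prob n) 0 <= rho) ->
  uniq S -> all on_diag S -> size S = k.+1 ->
  cover_prob n S x <= hit_prob n x * rho ^+ k.
Proof.
move=> rho0 rhoP; elim: n k S x => [|n IH] k S x uS dS sS.
  by rewrite cover_prob0 hit_prob0 mul0r /nilp sS.
have dS' := all_filterl (fun y => y != x) dS.
have uS' := filter_uniq (fun y => y != x) uS.
rewrite hit_probS; case: ifPn => dx; last first.
  have -> : cover_prob n.+1 S x = nbr_avg (cover_prob n S) x.
    rewrite cover_probS; congr (nbr_avg (cover_prob n _) x).
    by apply/all_filterP/allP => y /(allP dS); apply: contraTneq => ->.
  rewrite mulrC -nbr_avgZ; apply: ler_nbr_avg => e /=; rewrite [leRHS]mulrC.
  exact: IH.
case: k sS => [|k] sS; first by rewrite expr0 mulr1 cover_prob_le1.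
have [S'' [uS'' dS'' sS'' subS'']] : exists S'', [/\ uniq S'', all on_diag S'',
    size S'' = k.+1 & {subset S'' <= [seq y <- S | y != x]}].
  have le_size : (k.+1 <= size [seq y <- S | y != x])%N.
    rewrite -ltnS -sS -(count_predC (pred1 x) S) size_filter -[leqRHS]add1n.
    by apply: leq_add => //; rewrite count_uniq_mem// leq_b1.
  exists (take k.+1 [seq y <- S | y != x]); split.
  - exact: take_uniq.
  - by apply/allP => y /mem_take; exact: (allP dS').
  - by rewrite size_takel.
  - by move=> y /mem_take.
rewrite mul1r cover_probS.
have -> : rho ^+ k.+1 = rho ^+ k * rho by rewrite exprSr.
apply: (@le_trans _ _ (nbr_avg (fun z => rho ^+ k * hit_prob n z) x)).
  apply: ler_nbr_avg => e /=; rewrite [leRHS]mulrC.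
  apply: le_trans (IH _ _ _ uS'' dS'' sS''); exact: cover_prob_subset.
rewrite nbr_avgZ ler_wpM2l ?exprn_ge0//.
apply: le_trans (rhoP n); rewrite /nbr_avg le_eqVlt; apply/orP; left; apply/eqP.
congr (_ * _); apply: eq_bigr => e _.
by rewrite add0r addrC hit_prob_shift.
Qed.

End Hit.

(** * A superharmonic function of the distance to the diagonal *)

Section Potential.
Variables (R : realType).

Definition root4 (x : R) := Num.sqrt (Num.sqrt x).

Lemma root4_gt0 x : 0 < x -> 0 < root4 x.
Proof. by move=> x0; rewrite !sqrtr_gt0. Qed.

Lemma root4X x : 0 <= x -> root4 x ^+ 4 = x.
Proof.
by move=> x0; rewrite (exprM _ 2 2) sqr_sqrtr ?sqrtr_ge0// sqr_sqrtr.
Qed.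

(** A quadratic upper bound of (1 + t) ^ (-1/4) near 0.  The Taylor coefficient
    of t ^ 2 is 10/64; 11/64 leaves room for the higher order terms and is
    below 12/64, the value at which the proof of [pot_superharmonic] breaks
    down for d = 4. *)
Lemma quartic_ge1 (t : R) : -32^-1 <= t <= 32^-1 ->
  1 <= (1 - t / 4 + 11 / 64 * t ^+ 2) ^+ 4 * (1 + t).
Proof.
move=> /andP[t1 t2]; rewrite (exprM _ 2 2).
have tt : 0 <= t ^+ 2 by exact: sqr_ge0.
set w := 1 - _ + _.
(* The coefficients 2/5 and 83/80 of t ^ 2 are the exact ones, 13/32 and 21/20,
   lowered to absorb the higher order terms when |t| <= 1/32. *)
have w2 : 1 - t / 2 + 2 / 5 * t ^+ 2 <= w ^+ 2.
  rewrite -subr_ge0 (_ : _ - _ =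
    t ^+ 2 * (1 / 160 - 11 / 128 * t + 121 / 64 / 64 * t ^+ 2)).
    by rewrite mulr_ge0//; nra.
  by rewrite /w; field.
have w0 : 0 <= 1 - t / 2 + 2 / 5 * t ^+ 2 by lra.
have w4 : 1 - t + 83 / 80 * t ^+ 2 <= (w ^+ 2) ^+ 2.
  apply: (@le_trans _ _ ((1 - t / 2 + 2 / 5 * t ^+ 2) ^+ 2)).
    rewrite -subr_ge0 (_ : _ - _ =
      t ^+ 2 * (1 / 80 - 2 / 5 * t + 4 / 25 * t ^+ 2)).
      by rewrite mulr_ge0//; nra.
    by field.
  by rewrite ler_sqr// nnegrE// (le_trans w0).
apply: (@le_trans _ _ ((1 - t + 83 / 80 * t ^+ 2) * (1 + t))).
  rewrite -subr_ge0 (_ : _ - _ = t ^+ 2 * (3 / 80 + 83 / 80 * t)).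
    by rewrite mulr_ge0//; lra.
  by field.
by rewrite ler_pM2r//; lra.
Qed.

Lemma root4_le (s t : R) : 0 < s -> -32^-1 <= t <= 32^-1 ->
  (root4 (s * (1 + t)))^-1 <= (root4 s)^-1 * (1 - t / 4 + 11 / 64 * t ^+ 2).
Proof.
move=> s0 ht; have := quartic_ge1 ht; have /andP[t1 t2] := ht.
set w := 1 - _ + _ => hw.
have w0 : 0 < w by rewrite /w; nra.
have t10 : 0 < 1 + t by lra.
have st0 : 0 < s * (1 + t) by rewrite mulr_gt0.
have u0 := root4_gt0 st0; have r0 := root4_gt0 s0.
rewrite [leRHS]mulrC ler_pdivlMr// [leLHS]mulrC ler_pdivrMr//.
rewrite -(ler_pXn2r (n := 4))//; last first.
- by rewrite nnegrE mulr_ge0// ltW.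
- by rewrite nnegrE ltW.
rewrite exprMn !root4X ?(ltW s0) ?(ltW st0)//.
by rewrite mulrCA ler_peMr// ltW.
Qed.

Variable d : nat.
Hypothesis d_ge4 : (4 <= d)%N.
Implicit Types x : site d.

Definition mean x : R := (\sum_k (x ord0 k)%:~R) / d%:R.
Definition dev x k : R := (x ord0 k)%:~R - mean x.
Definition diag_dist2 x : R := \sum_k dev x k ^+ 2.

Let d0 : d%:R != 0 :> R. Proof. rewrite pnatr_eq0; lia. Qed.
Let d4 : 4 <= d%:R :> R. Proof. by rewrite ler_nat. Qed.

Lemma sum_dev x : \sum_k dev x k = 0.
Proof.
rewrite sumrB sumr_const card_ord -[mean x *+ d]mulr_natr /mean divfK//.
by rewrite subrr.
Qed.

Lemma mean_step x e : mean (x + stepv e) = mean x + (-1) ^+ e.2 / d%:R.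
Proof.
rewrite /mean -mulrDl; congr (_ / _).
under eq_bigr do rewrite siteD stepvE intrD.
rewrite big_split /=; congr (_ + _).
rewrite (bigD1 e.1)//= eqxx mulr1 big1 ?addr0 => [|k /negPf ->].
  by rewrite rmorphXn rmorphN1.
by rewrite mulr0.
Qed.

(** The projection of a unit vector on the hyperplane orthogonal to the diagonal
    has squared length 1 - 1/d. *)
Lemma diag_dist2_step x e : diag_dist2 (x + stepv e) =
  diag_dist2 x + 2 * (-1) ^+ e.2 * dev x e.1 + (1 - d%:R^-1).
Proof.
set s : R := (-1) ^+ e.2.
have devE k : dev (x + stepv e) k = dev x k + (s * (k == e.1)%:R - s / d%:R).
  rewrite /dev mean_step siteD stepvE intrD intrM -/s.
  have -> : ((-1) ^+ e.2)%:~R = s by rewrite rmorphXn rmorphN1.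
  have -> : ((k == e.1)%:R : int)%:~R = (k == e.1)%:R :> R by case: (k == _).
  ring.
have s2 : s ^+ 2 = 1 by rewrite sqrr_sign.
rewrite /diag_dist2; under eq_bigr do rewrite devE.
rewrite (eq_bigr (fun k => dev x k ^+ 2 + (- 2 * s / d%:R) * dev x k +
  (s ^+ 2 / d%:R ^+ 2) + (k == e.1)%:R *
    (2 * s * dev x e.1 + s ^+ 2 - 2 * s ^+ 2 / d%:R))); last first.
  move=> k _; case: eqP => [->|_] /=; by field.
rewrite !big_split /= -mulr_sumr sum_dev mulr0 addr0 sumr_const card_ord.
have delta (c : R) : \sum_(k < d) (k == e.1)%:R * c = c.
  by rewrite (bigD1 e.1)//= eqxx big1 ?addr0 ?mul1r => [|k /negPf ->];
     rewrite ?mul0r.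
rewrite delta s2 -mulr_natr; by field.
Qed.

(* With s = Q + a, a step changes s by at most 1 + 2 sqrt Q in absolute value,
   which is at most s / 32 when a >= 33 * 32. *)
Variable a : R.
Hypothesis a_large : 33 * 32 <= a.

Definition pot x : R := (root4 (diag_dist2 x + a))^-1.

Lemma diag_dist2_ge0 x : 0 <= diag_dist2 x.
Proof. by apply: sumr_ge0 => k _; exact: sqr_ge0. Qed.

Lemma dev2_le x k : dev x k ^+ 2 <= diag_dist2 x.
Proof.
by rewrite /diag_dist2 (bigD1 k)//= lerDl sumr_ge0// => l _; exact: sqr_ge0.
Qed.

Let a_gt0 : 0 < a.
Proof. move: d4 a_large; lra. Qed.

Lemma pot_gt0 x : 0 < pot x.
Proof.
rewrite invr_gt0 root4_gt0//; move: (diag_dist2_ge0 x) d4 a_large; lra.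
Qed.

Lemma dev_diag x k : Defs.diagonal x -> dev x k = 0.
Proof.
move=> [m ->]; rewrite /dev /mean (eq_bigr (fun=> m%:~R)) => [|l _].
  by rewrite sumr_const card_ord mxE -[_ *+ d]mulr_natr mulfK// subrr.
by rewrite mxE.
Qed.

Lemma diag_dist2_diag x : Defs.diagonal x -> diag_dist2 x = 0.
Proof.
by move=> dx; rewrite /diag_dist2 big1// => k _; rewrite dev_diag// expr0n.
Qed.

(** Expanding to second order by [root4_le], the first order terms in [dev]
    cancel between opposite steps.  With s = Q + a and q = 1 - 1/d, what remains
    is nonpositive as soon as (11/32) d q ^ 2 + (11/8) Q <= (d - 1) s / 2, and
    11/8 < 3/2 <= (d - 1) / 2: this is where d >= 4 is used. *)
Lemma pot_superharmonic x : nbr_avg pot x <= pot x.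
Proof.
set Q := diag_dist2 x; set s : R := Q + a.
have Q0 : 0 <= Q := diag_dist2_ge0 x.
have s0 : 0 < s by move: d4 a_large; rewrite /s; lra.
have q01 : 0 < (d%:R^-1 : R) <= 4^-1.
  by move: d4 => ?; rewrite invr_gt0 lef_pV2 ?posrE;
     [apply/andP; split| |]; lra.
have sN0 : s != 0 by rewrite gt_eqF.
pose q : R := 1 - d%:R^-1.
pose t (e : dir d) : R := (q + 2 * (-1) ^+ e.2 * dev x e.1) / s.
have potE e : pot (x + stepv e) = (root4 (s * (1 + t e)))^-1.
  rewrite /pot diag_dist2_step -/Q; congr (root4 _)^-1.
  rewrite [s * (1 + t e)]mulrDr mulr1 /t [s * (_ / s)]mulrC divfK// /s /q.
  by ring.
have t_small e : - 32^-1 <= t e <= 32^-1.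
  rewrite /t ler_pdivlMr// ler_pdivrMr//.
  have := dev2_le x e.1; rewrite -/Q; set y := dev x e.1 => hy.
  move: a_large d4 => a1 a2.
  have h1 := sqr_ge0 (y - 32); have h2 := sqr_ge0 (y + 32).
  by case: e.2; rewrite /s /q ?expr0 ?expr1; apply/andP; split; nra.
pose w (e : dir d) := 1 - t e / 4 + 11 / 64 * t e ^+ 2.
apply: (@le_trans _ _ ((2 * d)%:R^-1 * \sum_e pot x * w e)).
  apply: ler_wpM2l; first by rewrite invr_ge0.
  by apply: ler_sum => e _; rewrite potE; exact: root4_le.
rewrite -mulr_sumr mulrCA ler_piMr ?(ltW (pot_gt0 _))//.
pose A := 2 - q / (2 * s) + 11 / 32 * q ^+ 2 / s ^+ 2.
pose B := 11 / 8 / s ^+ 2.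
have -> : \sum_e w e = d%:R * A + B * Q.
  rewrite /Q /diag_dist2 mulr_sumr mulr_natl -[in A *+ d](card_ord d).
  rewrite -sumr_const.
  rewrite -big_split -(pair_big predT predT (fun k b => w (k, b)))/=.
  by apply: eq_bigr => k _; rewrite big_bool /w /t /A /B /= expr0 expr1; field.
rewrite ler_pdivrMl ?ltr0n ?muln_gt0//; last by lia.
rewrite mulr1 natrM -subr_ge0.
have -> : 2 * d%:R - (d%:R * A + B * Q) =
  (d%:R * q * (s / 2 - 11 / 32 * q) - 11 / 8 * Q) / s ^+ 2.
  by rewrite /A /B; field.
apply: divr_ge0; last exact: sqr_ge0.
have dq : d%:R * q = d%:R - 1 by rewrite /q mulrBr mulr1 divff.
rewrite dq /s; move: q01 d4 a_large (Q0) => ? ? ? ?.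
(* Products that turn the remaining inequality into a linear one. *)
have p1 : 0 <= (d%:R - 4) * Q by rewrite mulr_ge0//; lra.
have p2 : 0 <= (d%:R - 1) * (a / 2 - 11 / 32 * q).
  by rewrite mulr_ge0 /q; lra.
move: p1 p2; nra.
Qed.

(** The maximum principle: [pot] is superharmonic and equals [pot 0] on the
    diagonal. *)
Lemma hit_prob_le_pot n x : hit_prob R n x <= pot x / pot 0.
Proof.
have d_gt0 : (0 < d)%N by lia.
elim: n x => [|n IH] x.
  by rewrite hit_prob0 divr_ge0 ?(ltW (pot_gt0 _)).
rewrite hit_probS//; case: ifPn => dx.
  rewrite /pot !diag_dist2_diag ?divff//; last exact/asboolP.
  - by rewrite add0r invr_eq0 gt_eqF// root4_gt0.
  - exact: diag0.
rewrite ler_pdivlMr ?pot_gt0// mulrC -nbr_avgZ.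
apply: le_trans (pot_superharmonic x); apply: ler_nbr_avg => e.
by rewrite mulrC -ler_pdivlMr ?pot_gt0.
Qed.

Lemma nbr_avg_hit_prob_le n :
  nbr_avg (hit_prob R n) (0 : site d) <= (root4 (1 - d%:R^-1 + a))^-1 / pot 0.
Proof.
have d_gt0 : (0 < d)%N by lia.
rewrite -[leRHS](@nbr_avg_cst R d _ 0)//.
apply: ler_nbr_avg => e; apply: (le_trans (hit_prob_le_pot _ _)).
have p0 : 0 < (pot 0)^-1 by rewrite invr_gt0 pot_gt0.
rewrite ler_pM2r// /pot diag_dist2_step.
by rewrite diag_dist2_diag ?dev_diag ?mulr0 ?add0r//; exact: diag0.
Qed.

Lemma return_bound_lt1 : (root4 (1 - d%:R^-1 + a))^-1 / pot 0 < 1.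
Proof.
have q01 : 0 < (d%:R^-1 : R) <= 4^-1.
  by move: d4 => ?; rewrite invr_gt0 lef_pV2 ?posrE;
     [apply/andP; split| |]; lra.
rewrite ltr_pdivrMr ?pot_gt0// mul1r /pot diag_dist2_diag; last exact: diag0.
have a_pos := a_gt0; rewrite add0r ltf_pV2 ?posrE ?root4_gt0//; last by lra.
by rewrite !ltr_sqrt ?sqrtr_gt0; lra.
Qed.
End Potential.

Lemma return_prob_bounded_away (R : realType) d : (4 <= d)%N ->
  exists2 c : R, c < 1 &
  forall n, nbr_avg (hit_prob R n) (0 : site d) <= c.
Proof.
move=> d4; have h := lexx (33 * 32 : R).
by eexists; [exact: return_bound_lt1 d4 _ h | exact: nbr_avg_hit_prob_le].
Qed.

(** * From averages to probabilities *)

Section Law.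
Variables (R : realType) (disp : measure_display) (T : measurableType disp)
  (P : probability T R) (d : nat) (X : nat -> T -> 'rV[int]_d).
Hypotheses (d_gt0 : (0 < d)%N) (hX : simple_random_walk P X).
Local Open Scope ereal_scope.

Let c : R := ((2 * d)%:R^-1)%R.

(** Only one-dimensional preimages are measurable by hypothesis; countability of
    Z^d gives the joint ones. *)
Lemma measurable_walk n m (F : seq (site d) -> bool) :
  measurable [set w | F [seq X i w | i <- iota m n]].
Proof.
elim: n m F => [|n IH] m F /=.
  by case: (F [::]); [rewrite set_true | rewrite set_false].
rewrite (_ : [set _ | _] = \bigcup_(x : site d) (X m @^-1` [set x] `&`
    [set w | F (x :: [seq X i w | i <- iota m.+1 n])])).
  apply: (@countable_bigcupT_measurable _ _ (site d)) => [|x].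
    exact: countableP.
  apply: measurableI; first exact: (srw_measurable hX).
  exact: (IH _ (fun l => F (x :: l))).
apply/seteqP; split => w /=; first by exists (X m w).
by move=> [x _ [<-]].
Qed.

Lemma measurable_increment n x : measurable [set w | increment X n w = x].
Proof.
have := measurable_walk 2 n (fun l => (nth 0 l 1 - nth 0 l 0)%R == x).
rewrite (_ : [set _ | _] = [set w | increment X n w = x])//.
by apply/seteqP; split => w /= /eqP.
Qed.

(** The 2d unit steps exhaust the law of an increment, because their
    probabilities add up to 1. *)
Lemma split_increment m B : measurable B ->
  P B = \sum_(e : dir d) P (B `&` [set w | increment X m w = stepv e]).
Proof.
move=> mB; pose I (e : dir d) := [set w | increment X m w = stepv e].
have mI e : measurable (I e) by exact: measurable_increment.
have tI : trivIset setT I.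
  apply/trivIsetP => e f _ _ /eqP ef; apply/seteqP; split => w //= [].
  by rewrite /I /= => -> /stepv_inj.
pose U := \bigcup_e I e.
have mU : measurable U.
  apply: (@countable_bigcupT_measurable _ _ (dir d)) => //; exact: countableP.
have bigU (J : dir d -> set T) : (forall e, measurable (J e)) ->
    trivIset setT J -> P (\bigcup_e J e) = \sum_(e : dir d) P (J e).
  move=> mJ tJ; rewrite measure_fin_bigcup//; last exact: finite_finset.
  rewrite (_ : setT = [set` enum {: dir d}]).
    by rewrite -fsbig_seq ?enum_uniq// big_enum.
  by apply/seteqP; split => e //=; rewrite mem_enum.
have PU : P U = 1.
  rewrite bigU//; under eq_bigr do rewrite (srw_step hX) ?l1norm_stepv//.
  rewrite sumEFin sumr_const card_dir -[(_ *+ _)%R]mulr_natl mulfV//.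
  by rewrite pnatr_eq0 muln_eq0 -lt0n d_gt0.
have PU0 : P (~` U) = 0 by rewrite probability_setC// PU subee.
have PBU : P (B `\` U) = 0.
  apply: (subset_measure0 _ _ _ PU0); [exact: measurableD|exact: measurableC|].
  by move=> w [].
have -> : P B = P (B `\` U) + P (B `&` U) by exact: measureDI.
rewrite PBU add0e setI_bigcupr bigU// => [e|]; first exact: measurableI.
exact: trivIset_setIl.
Qed.

Definition cylinder (s : seq (dir d)) : set T :=
  [set w | [seq increment X i w | i <- iota 0 (size s)] =
           [seq stepv e | e <- s]].

Lemma cylinder_rcons s e : cylinder (rcons s e) =
  cylinder s `&` [set w | increment X (size s) w = stepv e].
Proof.
have iotaSr n : iota 0 n.+1 = rcons (iota 0 n) n.
  by rewrite -addn1 iotaD cats1.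
rewrite /cylinder size_rcons iotaSr; apply/seteqP; split => w /=.
  by rewrite !map_rcons => /rcons_inj[].
by rewrite !map_rcons => -[-> ->].
Qed.

Lemma measurable_cylinder s : measurable (cylinder s).
Proof.
elim/last_ind: s => [|s e IH].
  by rewrite (_ : cylinder _ = setT)//; apply/seteqP; split.
rewrite cylinder_rcons; apply: measurableI => //.
exact: measurable_increment.
Qed.

Lemma prob_cylinder s : P (cylinder s) = (c ^+ size s)%:E.
Proof.
pose e_ i := nth 0%R [seq stepv e | e <- s] i.
have := srw_indep hX (fun i => [set e_ i]) (iota_uniq 0 (size s)).
rewrite (_ : \bigcap_(i in _) _ = cylinder s) => [->|].
  rewrite (eq_big_seq (fun=> c%:E)) => [|i].
    by rewrite big_const_seq count_predT size_iota; elim: (size s) => //= n ->;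
       rewrite -EFinM exprS.
  rewrite mem_iota add0n => /= hi; apply: (srw_step hX).
  have e0 : dir d by case: (s) hi => // e0 _ _; exact: e0.
  by rewrite /e_ (nth_map e0)// l1norm_stepv.
apply/seteqP; split => w /=.
  move=> h; apply: (@eq_from_nth _ 0%R); rewrite !size_map size_iota// => i hi.
  rewrite (nth_map 0%N) ?size_iota// nth_iota// add0n; apply: h.
  by rewrite /= mem_iota.
move=> h i /=; rewrite mem_iota add0n => /= hi.
by rewrite /e_ -h (nth_map 0%N) ?size_iota// nth_iota.
Qed.

Lemma walk_cylinder s w : cylinder s w ->
  X (size s) w = (\sum_(e <- s) stepv e)%R.
Proof.
elim/last_ind: s => [|s e IH]; first by rewrite big_nil (srw_start hX).
rewrite cylinder_rcons size_rcons => -[/IH hs /= he].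
by rewrite -cats1 big_cat big_seq1 /= -hs -he /increment addrC subrK.
Qed.

(** Conditioning on a prescribed beginning [s] of the step sequence lets the
    induction peel off one step at a time, although independence is only known
    for the increments and not as a Markov property. *)
Lemma prob_walk_cylinder n s (F : seq (site d) -> bool) :
  P (cylinder s `&` [set w | F [seq X i w | i <- iota (size s) n]]) =
  (c ^+ size s * path_avg n (fun l => (F l)%:R) (\sum_(e <- s) stepv e))%:E.
Proof.
elim: n s F => [|n IH] s F /=.
  by case: (F [::]); rewrite ?set_true ?set_false ?setIT ?setI0 ?mulr1 ?mulr0
    ?measure0 ?prob_cylinder.
set x := (\sum_(e <- s) _)%R.
rewrite (split_increment (size s)); last first.
  apply: measurableI; first exact: measurable_cylinder.
  exact: (measurable_walk n.+1).
rewrite /nbr_avg mulrA -exprSr mulr_sumr -sumEFin; apply: eq_bigr => e _.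
have := IH (rcons s e) (fun l => F (x :: l)).
rewrite size_rcons -cats1 big_cat big_seq1 /= -/x => <-; congr (P _).
rewrite cats1 cylinder_rcons; apply/seteqP; split => w /= [[]].
  by move=> hs Fw hw; split=> //; rewrite /x -(walk_cylinder hs).
by move=> hs hw Fw; split=> //; split=> //; rewrite (walk_cylinder hs).
Qed.

Lemma prob_walk n (F : seq (site d) -> bool) :
  P [set w | F [seq X i w | i <- iota 0 n]] =
  (path_avg n (fun l => (F l)%:R) 0)%:E.
Proof.
have := prob_walk_cylinder n [::] F; rewrite expr0 mul1r big_nil => <-.
by congr (P _); apply/seteqP; split => w /=; [split | case].
Qed.

Lemma prob_bigcup_le (F : (set T)^nat) (b : \bar R) :
  (forall n, measurable (F n)) -> nondecreasing_seq F ->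
  (forall n, P (F n) <= b) -> P (\bigcup_n F n) <= b.
Proof.
move=> mF ndF Fb.
have h := @nondecreasing_cvg_mu _ T R P F mF (bigcupT_measurable _ mF) ndF.
rewrite -(cvg_lim _ h)//; apply: lime_le.
  by apply/cvg_ex; eexists; exact: h.
by apply: nearW => n; exact: Fb.
Qed.
End Law.

(** * Paths from the origin to a sphere *)

Lemma l1normD d (x y : site d) : (l1norm (x + y)%R <= l1norm x + l1norm y)%N.
Proof.
rewrite /l1norm -big_split leq_sum// => i _ /=; rewrite siteD. lia.
Qed.

(** A discrete intermediate value theorem, applied to the first index at which
    the norm is at least m. *)
Lemma path_levels d N K (p : 'I_K.+1 -> site d) m : connects_to_sphere N p ->
  (m <= N)%N -> exists i, l1norm (p i) = m.
Proof.
move=> hp mN; have hmax : (m <= l1norm (p ord_max))%N by rewrite (path_end hp).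
case: (@arg_minnP _ ord_max (fun i => m <= l1norm (p i))%N (@nat_of_ord _)
  hmax).
move=> i hi imin; exists i; apply/eqP; rewrite eqn_leq hi andbT.
case: (posnP i) => [i0|i_gt0].
  have -> : i = ord0 by apply: val_inj.
  by rewrite (path_start hp) /l1norm big1// => k _; rewrite mxE.
have i1 : (i.-1 < K.+1)%N by have := ltn_ord i; lia.
pose j := Ordinal i1.
have hj : (l1norm (p j) < m)%N.
  by rewrite ltnNge; apply/negP => /imin /=; lia.
have := path_step hp (i := j) (j := i) => /(_ _)/= step.
have {}step := step (esym (prednK i_gt0)).
have := l1normD (p j) (p i - p j); rewrite addrC subrK step; lia.
Qed.

Section CoverPaths.
Variables (R : realType) (d : nat).
Hypothesis d_gt0 : (0 < d)%N.

Lemma nbr_avg_gt0 (g : site d -> R) x e :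
  (forall z, 0 <= g z) -> 0 < g (x + stepv e) -> 0 < nbr_avg g x.
Proof.
move=> g0 ge; rewrite mulr_gt0 ?invr_gt0 ?ltr0n ?muln_gt0//.
by rewrite (bigD1 e)//= ltr_pwDl// sumr_ge0.
Qed.

Lemma hit_prob_ge0 n (x : site d) : 0 <= hit_prob R n x.
Proof.
rewrite -(path_avg_cst n 0 x d_gt0); apply: ler_path_avg => l; exact: ler0n.
Qed.

Lemma return_within_two_gt0 : 0 < nbr_avg (hit_prob R 2) (0 : site d).
Proof.
pose k := Ordinal d_gt0.
apply: (nbr_avg_gt0 (e := (k, true))); first exact: hit_prob_ge0.
rewrite hit_probS//; case: ifP => // _.
apply: (nbr_avg_gt0 (e := (k, false))); first exact: hit_prob_ge0.
have -> : 0 + stepv (k, true) + stepv (k, false) = 0 :> site d.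
  by rewrite /stepv /= expr0 expr1 scale1r scaleN1r add0r addNr.
by rewrite hit_probS// ifT//; apply/asboolP; exact: diag0.
Qed.

(** Adding the origin, which is covered at time 0, to the targets turns the k
    returns into k + 1 visits. *)
Lemma cover_diagonal_le (rho : R) n k : 0 <= rho ->
  (forall n, nbr_avg (hit_prob R n) (0 : site d) <= rho) ->
  cover_prob R n [seq const_mx (Posz j) | j <- iota 1 k] (0 : site d) <=
  rho ^+ k.
Proof.
move=> rho0 rhoP; case: k => [|k]; first by rewrite expr0 cover_prob_le1.
case: n => [|n]; first by rewrite cover_prob0 exprn_ge0.
pose S := [seq const_mx (Posz j) | j <- iota 0 k.+2] : seq (site d).
have inj : injective (fun j => const_mx (Posz j) : site d).
  move=> i j /(congr1 (fun x : site d => x ord0 (Ordinal d_gt0))).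
  by rewrite !mxE => -[].
have -> : cover_prob R n.+1 [seq const_mx (Posz j) | j <- iota 1 k.+1]
    (0 : site d) = cover_prob R n.+1 S (0 : site d).
  have z0 : const_mx (Posz 0) = 0 :> site d by [].
  by rewrite /S [in RHS]/= z0 [LHS]cover_probS [RHS]cover_probS [in RHS]/= eqxx.
apply: (@le_trans _ _ (hit_prob R n.+1 (0 : site d) * rho ^+ k.+1)).
  apply: cover_le_hit => //.
  - by rewrite map_inj_uniq// iota_uniq.
  - by apply/allP => _ /mapP[j _ ->]; apply/asboolP; exists (Posz j).
  - by rewrite size_map size_iota.
rewrite ler_piMl ?exprn_ge0// -(path_avg_cst n.+1 1 (0 : site d) d_gt0).
by apply: ler_path_avg => l; rewrite lern1 leq_b1.
Qed.

Lemma cover_path_le N K (p : 'I_K.+1 -> site d) n :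
  connects_to_sphere N p ->
  cover_prob R n (codom p) 0 <=
  cover_prob R n [seq const_mx (Posz j) | j <- iota 1 (N %/ d)] (0 : site d).
Proof.
move=> hp; pose q j := if [pick i | l1norm (p i) == (j * d)%N] is Some i
  then p i else 0.
have qP j : j \in iota 1 (N %/ d) ->
    l1norm (q j) = (j * d)%N /\ q j \in codom p.
  rewrite mem_iota => /andP[_ hj].
  have jdN : (j * d <= N)%N.
    by apply: leq_trans (leq_divM N d); rewrite leq_pmul2r// -ltnS -add1n.
  rewrite /q; case: pickP => [i /eqP hi|h]; first by split=> //; exact: codom_f.
  by have [i hi] := path_levels hp jdN; have := h i; rewrite hi eqxx.
apply: le_trans (cover_straighten R n d_gt0 (fun j hj => (qP j hj).1)).
by apply: cover_prob_subset => _ /mapP[j /qP[_ ?] ->].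
Qed.
End CoverPaths.

Theorem theorem1p5 (R : realType) (disp : measure_display)
    (T : measurableType disp) (P : probability T R) (d : nat)
    (X : nat -> T -> 'rV[int]_d) (hd : (4 <= d)%N)
    (hX : simple_random_walk P X) :
  (0 < P (diagonal_return X) < 1)%E /\
  forall (N K : nat) (p : 'I_K.+1 -> 'rV[int]_d),
    (1 <= N)%N -> connects_to_sphere N p ->
    (P [set w | trace p `<=` trace (X ^~ w)]
      <= P (diagonal_return X) ^+ (N %/ d)%N)%E.
Proof.
have d_gt0 : (0 < d)%N by lia.
(* The positions at times 1, ..., n: time 0 does not count as a return. *)
pose ret n := [set w | has (@on_diag d) [seq X i w | i <- iota 1 n]].
have ret_meas n : measurable (ret n).
  exact: (measurable_walk hX n 1 (has (@on_diag d))).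
have retE : diagonal_return X = \bigcup_n ret n.
  apply/seteqP; split => w.
    move=> [n [n0 hn]]; exists n => //; apply/hasP; exists (X n w).
      by apply: map_f; rewrite mem_iota; lia.
    exact/asboolP.
  move=> [n _ /hasP[_ /mapP[i + ->] /asboolP hi]].
  rewrite mem_iota => /andP[i0 _].
  by exists i.
have P_ret n : P (ret n) = (nbr_avg (hit_prob R n) (0 : site d))%:E.
  exact: (prob_walk d_gt0 hX n.+1 (fun l => has (@on_diag d) (behead l))).
have ret_ndecr : nondecreasing_seq ret.
  move=> m n mn; apply/subsetPset => w /hasP[_ /mapP[i + ->] hi].
  rewrite mem_iota => im; apply/hasP; exists (X i w) => //.
  by apply: map_f; rewrite mem_iota; lia.
have mret : measurable (diagonal_return X).
  by rewrite retE; exact: bigcupT_measurable.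
have [rho rhoE] : exists rho : R, P (diagonal_return X) = rho%:E.
  by exists (fine (P (diagonal_return X))); rewrite fineK// fin_num_measure.
have rho_ge n : nbr_avg (hit_prob R n) (0 : site d) <= rho.
  rewrite -lee_fin -rhoE -P_ret; apply: le_measure; rewrite ?inE//.
  by rewrite retE => w hw; exists n.
have rho_gt0 : 0 < rho.
  exact: lt_le_trans (return_within_two_gt0 R d_gt0) (rho_ge 2).
split.
  rewrite rhoE lte_fin rho_gt0 lte_fin /=.
  have [c c1 hc] := return_prob_bounded_away R hd; apply: le_lt_trans c1.
  rewrite -lee_fin -rhoE retE; apply: prob_bigcup_le => // n.
  by rewrite P_ret lee_fin.
move=> N K p _ hp; rewrite rhoE -EFin_expe.
pose cov n := [set w | all [in [seq X i w | i <- iota 0 n]] (codom p)].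
have cov_ndecr : nondecreasing_seq cov.
  move=> m n mn; apply/subsetPset => w /allP h.
  apply/allP => x /h /mapP[i + ->].
  by rewrite mem_iota => im; apply: map_f; rewrite mem_iota; lia.
have -> : [set w | trace p `<=` trace (X ^~ w)] = \bigcup_n cov n.
  apply/seteqP; split => w /=; last first.
    move=> [n _ /allP h] _ [i <-]; have /mapP[j _ ->] := h _ (codom_f p i).
    by exists j.
  move=> h; have /choice[t tE] : forall i, exists j, X j w = p i.
    by move=> i; apply: h; exists i.
  exists (\max_i t i).+1 => //; apply/allP => _ /codomP[i ->]; rewrite -tE.
  by apply: map_f; rewrite mem_iota /= add0n ltnS leq_bigmax.
apply: prob_bigcup_le => // n.
  exact: (measurable_walk hX n 0 (fun l => all [in l] (codom p))).
have -> := prob_walk d_gt0 hX n (fun l => all [in l] (codom p)).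
rewrite lee_fin; apply: (le_trans (cover_path_le R d_gt0 n hp)).
by apply: cover_diagonal_le => //; exact: ltW.
Qed.
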